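(* Talagrand's compact $\mathcal{T}\subset\{0,1\}^{\mathbb{N}^{\mathbb{N}}}$ is solid, Corson and not Eberlein. Therefore, $\mathcal{T}$ is not QWRN.
   Context: Compact spaces are Hausdorff. $\mathbb{N}=\{1,2,\dots\}$. Talagrand's compact $\mathcal{T}$ consists of all characteristic functions $1_A\in\{0,1\}^{\mathbb{N}^{\mathbb{N}}}$ of sets $A\subset\mathbb{N}^{\mathbb{N}}$ for which there exists $n\in\mathbb{N}$ such that for all $x,y\in A$ with $x\neq y$ we have $x(k)=y(k)$ for every $k=1,\dots,n$ and $x(n+1)\neq y(n+1)$; it carries the topology inherited from the product $\{0,1\}^{\mathbb{N}^{\mathbb{N}}}$. $\Sigma(\Gamma)$ is the set of all $x\in\mathbb{R}^\Gamma$ with countable support, with the product topology. A compact space is Corson if it is homeomorphic to a compact subspace of $\Sigma(\Gamma)$ for some set $\Gamma$, and Eberlein if it is homeomorphic to a weakly compact subset of a Banach space. A compact $K\subset\Sigma(\Gamma)$ is solid if for every $x\in K$ and every finite $A\subset\Gamma$, $x1_A\in K$ (here $x1_A$ agrees with $x$ on $A$ and is $0$ off $A$); for $\mathcal{T}$ this refers to $\Gamma=\mathbb{N}^{\mathbb{N}}$. A sequence $(A_n^0,A_n^1)_{n\in\mathbb{N}}$ of disjoint pairs of subsets of a set $S$ (i.e. $A_n^0\cap A_n^1=\emptyset$) is independent if for every $n\in\mathbb{N}$ and every $\varepsilon:\{1,\dots,n\}\to\{0,1\}$ we have $\bigcap_{k=1}^nA_k^{\varepsilon(k)}\neq\emptyset$.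 A family $(A_\alpha^0,A_\alpha^1)_{\alpha\in I}$ of disjoint pairs contains an independent sequence if there is a sequence $(\alpha_n)_{n\in\mathbb{N}}$ in $I$ such that $(A_{\alpha_n}^0,A_{\alpha_n}^1)_{n\in\mathbb{N}}$ is independent. A compact space $K$ is quasi WRN (QWRN) if there exist a set $\Lambda$ and a homeomorphic embedding of $K$ in $[0,1]^\Lambda$ such that for every $\varepsilon>0$ there exists a decomposition $\Lambda=\bigcup_{n\in\mathbb{N}}\Lambda_n^\varepsilon$ such that for all reals $p<q$ with $q-p>\varepsilon$ and every $n\in\mathbb{N}$, the family of pairs $(A_\alpha^0,A_\alpha^1)_{\alpha\in\Lambda_n^\varepsilon}$ does not contain independent sequences, where $A_\alpha^0=\{x\in K:x_\alpha<p\}$, $A_\alpha^1=\{x\in K:x_\alpha>q\}$, and $x_\alpha$ denotes the $\alpha$-th coordinate of the image of $x$ under the embedding. *)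

(* Defs.v *)
From HB Require Import structures.
From mathcomp Require Import all_boot all_order all_algebra.
From mathcomp Require Import all_classical all_reals all_analysis.
Import Order.TTheory GRing.Theory Num.Theory.
Import numFieldNormedType.Exports.

Set Implicit Arguments.
Unset Strict Implicit.
Unset Printing Implicit Defensive.

Local Open Scope classical_set_scope.
Local Open Scope ring_scope.

(** Homeomorphism onto the image. Powers [Y^I] with the product topology are
    written [{ptws I -> Y}]. *)
Definition embedding (X Y : topologicalType) (f : X -> Y) : Prop :=
  [/\ injective f, continuous f &
      forall U : set X, open U ->
        exists2 V : set Y, open V & f @` U = V `&` range f].

Definition homeomorphic_to_subspace (X Y : topologicalType) (L : set Y) : Prop :=
  exists f : X -> Y, embedding f /\ range f = L.
Arguments homeomorphic_to_subspace X {Y} L.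

(** The sigma-product [Sigma(G)] inside [R^G]. *)
Definition sigma_product (R : realType) (G : Type) : set {ptws G -> R} :=
  [set x | countable [set g | x g != 0]].
Arguments sigma_product : clear implicits.

(** [patch (fun=> 0) A x] agrees with [x] on [A] and vanishes off [A]. *)
Definition solid (R : realType) (G : Type) (K : set {ptws G -> R}) : Prop :=
  [/\ compact K, K `<=` sigma_product R G &
      forall (x : {ptws G -> R}) (A : set G), K x -> finite_set A ->
        K (patch (fun=> 0) A x)].

Definition corson (R : realType) (K : topologicalType) : Prop :=
  exists (G : Type) (L : set {ptws G -> R}),
    [/\ compact L, L `<=` sigma_product R G & homeomorphic_to_subspace K L].

Definition topological_dual (R : realType) (V : normedModType R) :
  set {linear V -> R^o} := [set f : {linear V -> R^o} | continuous f].
Arguments topological_dual {R} V.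

(** [V] with its weak topology, i.e. the initial topology for the evaluation
    map of [V] into [R^(V')], where [V'] is the topological dual of [V]. *)
Definition weak_space (R : realType) (V : normedModType R) : topologicalType :=
  initial_topology
    ((fun v f => set_val f v) : V -> {ptws topological_dual V -> R}).

Definition eberlein (R : realType) (K : topologicalType) : Prop :=
  exists (V : completeNormedModType R) (W : set (weak_space V)),
    compact W /\ homeomorphic_to_subspace K W.

(** The pairs of a sequence are indexed from 0: the [n] first pairs are those
    of index [k < n]. [false] and [true] stand for 0 and 1. *)
Definition independent_pairs (S : Type) (A : nat -> bool -> set S) : Prop :=
  (forall n, A n false `&` A n true = set0) /\
  (forall n, (0 < n)%N -> forall e : 'I_n -> bool,
     \bigcap_(k in [set: 'I_n]) A k (e k) !=set0).

Definition contains_independent_pairs (S I : Type) (J : set I)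
    (A : I -> bool -> set S) : Prop :=
  exists a : nat -> I, (forall n, J (a n)) /\ independent_pairs (A \o a).

(** To be used for compact Hausdorff [K]. *)
Definition qwrn (R : realType) (K : topologicalType) : Prop :=
  exists (I : Type) (f : K -> {ptws I -> R}),
    [/\ embedding f, forall x i, 0 <= f x i <= 1 &
        forall eps : R, 0 < eps ->
        exists J : nat -> set I, \bigcup_n J n = [set: I] /\
          forall p q : R, p < q -> q - p > eps -> forall n,
            ~ contains_independent_pairs (J n)
                (fun i b => if b then [set x | f x i > q]
                            else [set x | f x i < p])].

(** Points of N^N, with N = {1, 2, ...}, are encoded as [x : nat -> nat] by
    shifting both indices and values by one: x(k) is [(x k.-1).+1]. So the
    coordinates 1, ..., n are those of index [k < n], and the coordinate n + 1
    is that of index [n]. *)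
Definition talagrand_family : set (set (nat -> nat)) :=
  [set A | exists2 n, (0 < n)%N &
     forall x y, A x -> A y -> x <> y ->
       (forall k, (k < n)%N -> x k = y k) /\ x n <> y n].

(** Talagrand's compact, seen in [R^(N^N)], which contains [{0,1}^(N^N)] as a
    topological subspace. As a topological space of its own, it is
    [set_type (talagrand R)], which carries the subspace topology. *)
Definition talagrand (R : realType) : set {ptws (nat -> nat) -> R} :=
  [set \1_A | A in talagrand_family].
Arguments talagrand : clear implicits.

(* Main.v *)
Require Import Defs.
From HB Require Import structures.
From mathcomp Require Import all_boot all_order all_algebra.
From mathcomp Require Import all_classical all_reals all_analysis.
Import Order.TTheory GRing.Theory Num.Theory.
Import numFieldNormedType.Exports.

Set Implicit Arguments.
Unset Strict Implicit.
Unset Printing Implicit Defensive.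

Local Open Scope classical_set_scope.
Local Open Scope ring_scope.

(** Solidity and compactness: membership of a set in [talagrand_family] only
    depends on its subsets with at most four elements.

    Negative part: let [f i], for [i] in [I], be continuous functions separating
    the points of Talagrand's compact. For each [x] some [f i] separates [1_{x}]
    from [0], say by rational levels [p < q]; by continuity there is [l] such
    that, whenever all points of [A] agree with [x] on the first [l]
    coordinates, the side on which [f i (1_A)] lies only depends on whether [x]
    is in [A]. Given a decomposition of [I] for each [(p, q)], only countably
    many cases occur, so by Baire's theorem in [N^N] one case contains points
    [x_j] that all agree on the first [d >= l] coordinates and satisfy
    [x_j(d) = j]. All subsets of [{x_j}] belong to [talagrand_family], so the
    functions attached to the [x_j] form an independent sequence in one piece
    of the decomposition.

    A weakly compact set carries a decomposed separating family without
    independent sequences, namely the dual space cut into the sets of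
    functionals of norm at most [n], by Grothendieck's double limit argument
    along an ultrafilter. This excludes Eberlein compacts too. *)

(** * Pointwise convergence and ultrafilters *)

Lemma ptws_eval_continuous (G : Type) (Y : topologicalType) (g : G) :
  continuous (fun h : {ptws G -> Y} => h g).
Proof. exact: (@proj_continuous {classic G} (fun=> Y) g). Qed.

Lemma cvg_initial (S : choiceType) (Y : topologicalType) (f : S -> Y)
    (F : set_system S) (s : S) : Filter F ->
  f x @[x --> F] --> f s -> F --> (s : initial_topology f).
Proof.
move=> FF Ff A [_ [[B Bop <-] Bfs] BA].
have FB : F (f @^-1` B) by apply: Ff; exact: open_nbhs_nbhs.
exact: filterS BA FB.
Qed.

Lemma ptws_cvg (G : Type) (Y : topologicalType)
    (F : set_system {ptws G -> Y}) (f : {ptws G -> Y}) : Filter F ->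
  (forall g, h g @[h --> F] --> f g) -> F --> f.
Proof. by move=> FF Fg; apply/cvg_sup => g; apply: cvg_initial; exact: Fg. Qed.

Lemma ultra_fmap (S T : Type) (f : S -> T) (F : set_system S) :
  UltraFilter F -> UltraFilter (f x @[x --> F]).
Proof.
move=> FU; split; first exact: fmap_proper_filter.
move=> G GF FG; apply/seteqP; split=> A; last exact: FG.
move=> GA; case: (in_ultra_setVsetC (f @^-1` A) FU) => // FnA.
have /FG GnA : (f x @[x --> F]) (~` A) by [].
by have [x []] := filter_ex (filterI GA GnA).
Qed.

(** * Baire's theorem in N^N *)

Definition agree (n : nat) (x y : nat -> nat) : Prop :=
  forall k, (k < n)%N -> x k = y k.

Lemma agree_sym n x y : agree n x y -> agree n y x.
Proof. by move=> xy k kn; rewrite xy. Qed.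

Lemma agree_trans n x y z : agree n x y -> agree n y z -> agree n x z.
Proof. by move=> xy yz k kn; rewrite xy// yz. Qed.

Lemma agree_leq m n x y : (m <= n)%N -> agree n x y -> agree m x y.
Proof. by move=> mn xy k km; rewrite xy// (leq_trans km). Qed.

(** Otherwise every cylinder contains a smaller one missing [P k]; cylinders chosen this way for k =
    0, 1, ... shrink to a point outside all [P k]. A pair [(s, m)] stands for the cylinder of all
    [t] with [agree m s t]. *)
Lemma baire_sequences (P : nat -> set (nat -> nat)) :
  (forall x, exists k, P k x) ->
  exists k (s : nat -> nat) m, forall t j, agree m s t ->
    exists2 x, P k x & agree j x t.
Proof.
move=> Pcover; apply/not_existsP => nP.
have step (k : nat) (sm : (nat -> nat) * nat) : exists tj : (nat -> nat) * nat,
    [/\ agree sm.2 sm.1 tj.1, (sm.2 < tj.2)%N &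
        forall x, P k x -> ~ agree tj.2 x tj.1].
  case: sm => s m; apply: contrapT => nex; apply: (nP k); exists s, m => t j st.
  (* The length grows strictly, so that the nested cylinders fix every coordinate in the end. *)
  apply: contrapT => nx; apply: nex; exists (t, maxn m.+1 j); split => //=.
    exact: leq_maxl.
  move=> x Px /(agree_leq (leq_maxr m.+1 j)) xt; apply: nx; by exists x.
pose next k sm := projT1 (cid (step k sm)).
have nextP k sm := projT2 (cid (step k sm)).
pose s := fix s k := if k is k'.+1 then next k' (s k') else (fun=> 0%N, 0%N).
have sP k : [/\ agree (s k).2 (s k).1 (s k.+1).1, ((s k).2 < (s k.+1).2)%N &
    forall x, P k x -> ~ agree (s k.+1).2 x (s k.+1).1] by exact: nextP.
have s_le k d : agree (s k).2 (s k).1 (s (k + d)%N).1 /\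
    ((s k).2 <= (s (k + d)%N).2)%N.
  elim: d => [|d [IH1 IH2]]; first by rewrite addn0.
  rewrite addnS; have [a l _] := sP (k + d)%N; split.
    by apply: agree_trans IH1 _; exact: agree_leq a.
  exact: leq_trans IH2 (ltnW l).
have s_ge k : (k <= (s k).2)%N.
  by elim: k => // k IH; have [_ l _] := sP k; exact: leq_ltn_trans l.
(* The limit of the nested sequence of cylinders [(s k)]. *)
pose x i := (s i.+1).1 i.
have xs k : agree (s k).2 x (s k).1.
  move=> i ik; rewrite /x; have [ki|/ltnW ki] := leqP k i.+1.
    by rewrite -(subnKC ki); have [-> ] := s_le k (i.+1 - k)%N.
  by rewrite -(subnKC ki); have [-> //] := s_le i.+1 (k - i.+1)%N.
have [k Pk] := Pcover x.
by have [_ _ /(_ _ Pk)] := sP k; apply; exact: xs.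
Qed.

(** * Solidity, compactness and the Corson property *)

Lemma talagrand_family_sub (A B : set (nat -> nat)) :
  A `<=` B -> talagrand_family B -> talagrand_family A.
Proof. by move=> AB [n n0 Bn]; exists n => // x y /AB Bx /AB; exact: Bn. Qed.

(** Two distinct points [x], [y] of [A] determine [n], the first coordinate where they differ. Any
    further pair [z], [w] lies with them in one member of the family, whose level must then be the
    same [n]. *)
Lemma talagrand_family_finite_character (A : set (nat -> nat)) :
  (forall x y z w, A x -> A y -> A z -> A w ->
     exists2 B, talagrand_family B & [/\ B x, B y, B z & B w]) ->
  talagrand_family A.
Proof.
move=> AB; have [[[x y] /= [Ax Ay xy]]|nA] :=
    pselect (exists xy, [/\ A xy.1, A xy.2 & xy.1 <> xy.2]); last first.
  by exists 1%N => // x y Ax Ay xy; exfalso; apply: nA; exists (x, y).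
have [B [n n0 Bn] [Bx By _ _]] := AB x y x y Ax Ay Ax Ay.
exists n => // z w Az Aw.
have [C [m m0 Cm] [Cx Cy Cz Cw]] := AB x y z w Ax Ay Az Aw.
suff -> : n = m by exact: Cm.
have [xyn xyn'] := Bn x y Bx By xy; have [xym xym'] := Cm x y Cx Cy xy.
by case: (ltngtP n m) => // [/xym|/xyn].
Qed.

(** The coordinate of index [n] already distinguishes the points of [A]. *)
Lemma talagrand_family_countable (A : set (nat -> nat)) :
  talagrand_family A -> countable A.
Proof.
move=> [n _ An]; apply/countable_injP; exists (fun x => x n).
move=> x y /set_mem Ax /set_mem Ay xyn; apply: contrapT => xy.
by have [_] := An x y Ax Ay xy.
Qed.

Lemma talagrandP (R : realType) (h : {ptws (nat -> nat) -> R}) :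
  talagrand R h <-> (forall x, h x = 0 \/ h x = 1) /\
                    talagrand_family [set x | h x != 0].
Proof.
split=> [[A TA <-]|[h01 Th]].
  split=> [x|]; first by rewrite indicE; case: (x \in A); [right|left].
  apply: talagrand_family_sub TA => x /=; rewrite indicE.
  by have [/set_mem //|] := boolP (x \in A); rewrite eqxx.
exists [set x | h x != 0] => //; apply/funext => x; rewrite indicE.
case: (h01 x) => hx.
  by rewrite memNset//= hx eqxx.
by rewrite mem_set//= hx oner_eq0.
Qed.

Lemma talagrand_compact (R : realType) : compact (talagrand R).
Proof.
have cube : compact [set h : {ptws (nat -> nat) -> R} |
    forall x, [set 0; 1] (h x)].
  apply: (@tychonoff {classic (nat -> nat)} (fun=> R) (fun=> [set 0; 1])) => _.
  by apply: finite_compact; exact: finite_set2.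
rewrite compact_ultra => F FU FT; move: cube; rewrite compact_ultra.
move=> /(_ F FU); case=> [|h [/= h01 Fh]].
  by apply: filterS FT => g /talagrandP[].
exists h; split => //; apply/talagrandP; split => //.
(* Being nonzero at [x] is an open condition, so any four points of the support of the limit [h] lie
   in the support of a single member of [talagrand R]. *)
have Fpos x : h x != 0 -> \forall g \near F, g x != 0.
  move=> hx; apply: (Fh [set g : {ptws _ -> _} | g x != 0]).
  apply: (@ptws_eval_continuous _ R x h [set r | r != 0]).
  by apply: open_nbhs_nbhs; split => //; exact: open_neq.
apply: talagrand_family_finite_character => x y z w /= hx hy hz hw.
have [g] : exists g : {ptws (nat -> nat) -> R},
    [/\ talagrand R g, g x != 0, g y != 0, g z != 0 & g w != 0].
  near F => g; exists g; split; near: g; by [exact: FT|exact: Fpos].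
by move=> [/talagrandP[_ Tg] ? ? ? ?]; exists [set x | g x != 0].
Unshelve. all: by end_near. Qed.

Lemma talagrand_solid (R : realType) : solid (talagrand R).
Proof.
split; first exact: talagrand_compact.
  by move=> h /talagrandP[_ Th]; exact: talagrand_family_countable.
move=> h A /talagrandP[h01 Th] _; apply/talagrandP; split=> [x|].
  by rewrite patchE; case: ifP => _; [exact: h01|left].
apply: talagrand_family_sub Th => x /=; rewrite patchE.
by case: ifP => //; rewrite eqxx.
Qed.

Lemma set_val_embedding (X : topologicalType) (A : set X) :
  embedding (set_val : set_type A -> X).
Proof.
split; [exact: val_inj|exact: initial_continuous|].
move=> _ [V oV <-]; exists V => //; apply/seteqP; split=> [_ [x Vx <-]|x].
  by split => //; exists x.
by move=> [Vx [y _ yx]]; exists y => //=; rewrite yx.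
Qed.

Lemma talagrand_corson (R : realType) : corson R (set_type (talagrand R)).
Proof.
have [cT TS _] := talagrand_solid R.
exists (nat -> nat), (talagrand R); split => //.
exists set_val; split; first exact: set_val_embedding.
apply/seteqP; split=> [_ [u _ <-]|h Th]; first exact/set_mem/valP.
by exists (exist _ h (mem_set Th)).
Qed.

(** * Separating families on Talagrand's compact *)

Definition level_pairs (R : realType) (S I : Type) (f : S -> I -> R) (p q : R)
    (i : I) (b : bool) : set S :=
  if b then [set x | f x i > q] else [set x | f x i < p].

(** The decomposition clause of [qwrn] for arbitrary real functions, so that it also covers
    functionals on a weakly compact set. *)
Definition without_independent_pairs (R : realType) (S I : Type)
    (f : S -> I -> R) : Prop :=
  forall eps : R, 0 < eps ->
  exists J : nat -> set I, \bigcup_n J n = [set: I] /\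
    forall p q : R, p < q -> q - p > eps -> forall n,
      ~ contains_independent_pairs (J n) (level_pairs f p q).

Lemma talagrand_nbhs (R : realType) (u : set_type (talagrand R))
    (x : nat -> nat) (U : set (set_type (talagrand R))) :
  (forall y, y <> x -> set_val u y = 0) -> nbhs u U ->
  exists l, forall v : set_type (talagrand R),
    (forall y, set_val v y != 0 -> agree l x y) ->
    set_val v x = set_val u x -> U v.
Proof.
move=> ux Uu; apply: contrapT => nl.
have /choice[v vP] : forall l, exists v : set_type (talagrand R),
    [/\ forall y, set_val v y != 0 -> agree l x y,
        set_val v x = set_val u x & ~ U v].
  move=> l; apply: contrapT => nv; apply: nl; exists l => v v1 v2.
  by apply: contrapT => nU; apply: nv; exists v.
(* The supports of the [v l] shrink to [{x}], so [v l] tends to [u]. *)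
have vu : v l @[l --> \oo] --> u.
  apply: cvg_initial; apply: ptws_cvg => y.
  apply: (@cvg_near_cst _ _ _ (fun l => set_val (v l) y)).
  have [->|yx] := pselect (y = x).
    by apply: nearW => l; have [] := vP l.
  have [k yxk] : exists k, y k <> x k.
    by apply/existsNP => yx'; apply: yx; exact/funext.
  near=> l; rewrite (ux y yx); apply: contrapT => /eqP vy.
  have [/(_ y vy k) kl _ _] := vP l; apply: yxk; rewrite kl//.
  by near: l; exact: nbhs_infty_gt.
have [l _ /(_ l (leqnn l)) /= Ul] := vu U Uu.
by have [] := vP l.
Unshelve. all: by end_near. Qed.

Lemma talagrand_indic (R : realType) (A : set (nat -> nat)) :
  talagrand_family A -> exists u : set_type (talagrand R), set_val u = \1_A.
Proof.
move=> TA; have T1A : talagrand R \1_A by exists A.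
by exists (exist (fun h => h \in talagrand R) _ (mem_set T1A)).
Qed.

(** The bit [b] is the side on which the function of index [i] puts the indicator of [{x}]; the
    indicator of the empty set lies on the other side. Rational levels leave only countably many
    cases. *)
Lemma talagrand_level_pairs (R : realType) (I : Type)
    (f : set_type (talagrand R) -> I -> R) (x : nat -> nat) :
  (forall i, continuous (f^~ i)) -> injective f ->
  exists i (p q : rat) l b, p < q /\ forall v : set_type (talagrand R),
    (forall y, set_val v y != 0 -> agree l x y) ->
    level_pairs f (ratr p) (ratr q) i (b (+) (set_val v x == 0)) v.
Proof.
move=> fc fI.
have [u0 u0E] : exists u : set_type (talagrand R), set_val u = \1_set0.
  by apply: talagrand_indic; exists 1%N.
have [u1 u1E] : exists u : set_type (talagrand R), set_val u = \1_[set x].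
  by apply: talagrand_indic; exists 1%N => // y z -> ->.
have u00 y : set_val u0 y = 0 by rewrite u0E indicE memNset.
have u1x : set_val u1 x = 1 by rewrite u1E indicE mem_set.
have u10 y : y <> x -> set_val u1 y = 0.
  by move=> yx; rewrite u1E indicE memNset.
have T01 (v : set_type (talagrand R)) y : set_val v y != 0 -> set_val v y = 1.
  have /set_mem/talagrandP[v01 _] := valP v.
  have [->|//] : set_val v y = 0 \/ set_val v y = 1 := v01 y.
  by rewrite eqxx.
have [i fi] : exists i, f u1 i != f u0 i.
  apply: contrapT => nfi.
  have /fI/(congr1 (fun u => set_val u x)) : f u1 = f u0.
    apply/funext => i; apply: contrapT => /eqP fi; apply: nfi; by exists i.
  by rewrite u00 u1x => /eqP; rewrite oner_eq0.
have nbhs_gt u r : r < f u i -> nbhs u [set v | r < f v i].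
  move=> ru; apply: (fc i u [set s | r < s]).
  by apply: open_nbhs_nbhs; split => //; exact: open_gt.
have nbhs_lt u r : f u i < r -> nbhs u [set v | f v i < r].
  move=> ru; apply: (fc i u [set s | s < r]).
  by apply: open_nbhs_nbhs; split => //; exact: open_lt.
have between (a b : R) : a < b -> exists p q : rat,
    [/\ p < q, a < ratr p & ratr q < b].
  move=> /rat_in_itvoo[p /itvP pab].
  have /rat_in_itvoo[q /itvP qpb] : ratr p < b by rewrite pab.
  exists p, q; split; rewrite ?pab ?qpb//.
  by rewrite -(ltr_rat R) qpb.
move: fi; rewrite neq_lt => /orP[|] /between[p [q [pq lp qr]]].
  have [l0 l0P] := @talagrand_nbhs R u0 x _ (fun y _ => u00 y) (nbhs_gt _ _ qr).
  have [l1 l1P] := talagrand_nbhs u10 (nbhs_lt _ _ lp).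
  exists i, p, q, (maxn l0 l1), false; split => // v vl.
  case: eqP => [vx|/eqP vx] /=.
    apply: l0P; last by rewrite u00.
    by move=> y /vl; apply: agree_leq; exact: leq_maxl.
  apply: l1P; last by rewrite u1x T01.
  by move=> y /vl; apply: agree_leq; exact: leq_maxr.
have [l0 l0P] := @talagrand_nbhs R u0 x _ (fun y _ => u00 y) (nbhs_lt _ _ lp).
have [l1 l1P] := talagrand_nbhs u10 (nbhs_gt _ _ qr).
exists i, p, q, (maxn l0 l1), true; split => // v vl.
case: eqP => [vx|/eqP vx] /=.
  apply: l0P; last by rewrite u00.
  by move=> y /vl; apply: agree_leq; exact: leq_maxl.
apply: l1P; last by rewrite u1x T01.
by move=> y /vl; apply: agree_leq; exact: leq_maxr.
Qed.

Lemma talagrand_independent_pairs (R : realType) (I : Type)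
    (f : set_type (talagrand R) -> I -> R) :
  (forall i, continuous (f^~ i)) -> injective f ->
  ~ without_independent_pairs f.
Proof.
move=> fc fI fJ.
have /choice[J JP] : forall pq : rat * rat, exists J : nat -> set I,
    \bigcup_n J n = [set: I] /\ (pq.1 < pq.2 -> forall n,
      ~ contains_independent_pairs (J n)
          (level_pairs f (ratr pq.1) (ratr pq.2))).
  move=> [p q]; have [pq|_] := ltP p q; last first.
    by exists (fun=> setT); split => //; rewrite bigcup_const//; exists 0%N.
  have pqR : ratr p < ratr q :> R by rewrite ltr_rat.
  have qp0 : 0 < (ratr q - ratr p : R) by rewrite subr_gt0.
  (* Half the gap, because [q - p] must exceed [eps] strictly. *)
  have [|J [JT JP]] := fJ ((ratr q - ratr p) / 2); first by rewrite divr_gt0.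
  exists J; split => // _; apply: JP => //.
  by rewrite ltr_pdivrMr// mulr_natr mulr2n ltrDl.
(* [c] lists the piece number, the levels, the length of agreement and the
   orientation. *)
pose good (c : nat * (rat * rat) * nat * bool) x i :=
  let: (n, (p, q), l, b) := c in
  [/\ J (p, q) n i, p < q & forall v : set_type (talagrand R),
    (forall y, set_val v y != 0 -> agree l x y) ->
    level_pairs f (ratr p) (ratr q) i (b (+) (set_val v x == 0)) v].
(* Numbers that encode no case get the empty set, which is dense in no cylinder. *)
pose P k x := if unpickle k is Some c then exists i, good c x i else False.
have [x|c [s [m dense]]] := @baire_sequences P.
  have [i [p [q [l [b [pq fx]]]]]] := talagrand_level_pairs x fc fI.
  have [JT _] := JP (p, q).
  have [n _ Jn] : (\bigcup_n J (p, q) n) i by rewrite JT.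
  exists (pickle (n, (p, q), l, b)); rewrite /P pickleK; by exists i.
move: dense; rewrite /P; case: unpickle => [[[[n [p q]] l] b]|dense];
  last first.
  by have [] := dense s m (fun _ _ => erefl).
move=> dense.
(* [d] is at least [m] to stay in the cylinder where the case is dense, at least [l] for the level
   pairs to apply, and positive as [talagrand_family] requires. *)
pose d := maxn (maxn m l) 1.
have /choice[x xP] : forall j : nat, exists x, [/\ agree d s x, x d = j &
    exists i, good (n, (p, q), l, b) x i].
  (* Density is applied to [s] with its coordinate [d] changed to [j], up to [d] included. *)
  move=> j; pose t k := if k == d then j else s k.
  have st : agree d s t by move=> k kd; rewrite /t ltn_eqF.
  have [|x xgood xt] := dense t d.+1.
    by apply: agree_leq st; rewrite /d -maxnA leq_maxl.
  exists x; split => //; last by rewrite xt// /t eqxx.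
  by apply: agree_trans st _; apply: agree_sym; exact: agree_leq xt.
have /choice[a aP] : forall j, exists i, good (n, (p, q), l, b) (x j) i.
  by move=> j; have [] := xP j.
have pq : p < q by have [] := aP 0%N.
have [_ /(_ pq n)] := JP (p, q); apply.
exists a; split; first by move=> j; have [] := aP j.
split=> [j|k _ e].
  apply/seteqP; split=> // v [/= vp vq].
  by have := lt_trans vq vp; rewrite ltr_rat => /(lt_trans pq); rewrite ltxx.
(* The points [x j] with [e j = b] are selected, so that [b (+) (\1_A (x j) == 0)] equals [e j]; the
   coordinate [d] recovers [j] from [x j]. *)
pose A := [set x j | j in [set j | exists jk : (j < k)%N, e (Ordinal jk) == b]].
have TA : talagrand_family A.
  exists d; first by rewrite /d leq_maxr.
  move=> _ _ [j _ <-] [j' _ <-] xjj'.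
  have [sj xj _] := xP j; have [sj' xj' _] := xP j'.
  split; first exact: agree_trans (agree_sym sj) sj'.
  by rewrite xj xj' => jj'; apply: xjj'; rewrite jj'.
have [v vE] := talagrand_indic R TA.
exists v => j _; have [_ _ /(_ v)] := aP j; rewrite vE indicE.
have -> : (b (+) ((x j \in A)%:R == 0 :> R)) = e j.
  have -> : (x j \in A) = (e j == b).
    apply/idP/idP => [/set_mem[j' [j'k ej'] xj'j]|ejb].
      suff <- : Ordinal j'k = j by [].
      apply: val_inj => /=; have [_ <- _] := xP j'; have [_ {2}<- _] := xP j.
      by rewrite xj'j.
    apply: mem_set; exists j => //; exists (ltn_ord j).
    by rewrite (_ : Ordinal _ = j)//; exact: val_inj.
  by case: (b); case: (e j); rewrite /= ?eqxx ?oner_eq0.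
apply=> y; rewrite indicE; have [/set_mem[j' _ <-] _|] := boolP (y \in A);
  last by rewrite eqxx.
apply: (@agree_leq _ d); first by rewrite /d -maxnA leq_max leq_maxl orbT.
have [sj _ _] := xP j; have [sj' _ _] := xP j'.
exact: agree_trans (agree_sym sj) sj'.
Qed.

(** * Grothendieck's double limit argument and weakly compact sets *)

(** Limits in [k] along [F] give points [y m] with [g n (y m)] at least [q] for [n < m] and at most
    [p] for [m <= n]. At a limit [z] of the [y m], the two iterated limits of [g n (y m)] both equal
    [g' z], which contradicts [p < q]. *)
Lemma compact_double_limit (R : realType) (X : topologicalType) (W : set X)
    (F : set_system nat) (g : nat -> X -> R) (g' : X -> R) (p q : R) :
  UltraFilter F -> \oo `<=` F -> compact W ->
  (forall n, continuous (g n)) -> continuous g' ->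
  (forall x, W x -> g n x @[n --> F] --> g' x) -> p < q ->
  ~ forall m k, exists2 x, W x &
      forall n, (n < k)%N -> if (n < m)%N then q < g n x else g n x < p.
Proof.
move=> FU Foo cW gc g'c gg' pq pairs.
have FP := @ultra_proper _ _ FU.
have eventually_gt n : \forall k \near F, (n < k)%N.
  by apply: Foo; exact: nbhs_infty_gt.
have ultralimit (x : nat -> X) : (forall k, W (x k)) ->
    exists2 y, W y & x k @[k --> F] --> y.
  move=> Wx; move: cW; rewrite compact_ultra.
  move=> /(_ _ (ultra_fmap x FU)); case=> [|y [Wy xy]]; last by exists y.
  by apply: nearW => k; exact: Wx.
have /choice[y yP] m : exists y, [/\ W y, forall n, (n < m)%N -> q <= g n y &
    forall n, (m <= n)%N -> g n y <= p].
  have /choice[x xP] : forall k, exists x, W x /\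
      forall n, (n < k)%N -> if (n < m)%N then q < g n x else g n x < p.
    by move=> k; have [x Wx xP] := pairs m k; exists x.
  have [|y Wy xy] := ultralimit x; first by move=> k; have [] := xP k.
  have gxy n : g n (x k) @[k --> F] --> g n y.
    by apply: cvg_comp xy _; exact: gc.
  exists y; split=> // n nm.
    apply: cvgr_to_ge (gxy n) _; near=> k.
    have [_ /(_ n)] := xP k; rewrite nm => xk; apply/ltW/xk.
    by near: k; exact: eventually_gt.
  apply: cvgr_to_le (gxy n) _; near=> k.
  have [_ /(_ n)] := xP k; rewrite (leq_gtF nm) => xk; apply/ltW/xk.
  by near: k; exact: eventually_gt.
have [|z Wz yz] := ultralimit y; first by move=> m; have [] := yP m.
(* Limit in [m] first, then in [n]. *)
have : q <= g' z.
  apply: cvgr_to_ge (gg' z Wz) _; near=> n.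
  have gyz : g n (y m) @[m --> F] --> g n z.
    by apply: cvg_comp yz _; exact: gc.
  apply: cvgr_to_ge gyz _; near=> m.
  have [_ + _] := yP m; apply; near: m; exact: eventually_gt.
(* Limit in [n] first, then in [m]. *)
apply/negP; rewrite -ltNge; apply: le_lt_trans pq.
have gyz : g' (y m) @[m --> F] --> g' z by apply: cvg_comp yz _; exact: g'c.
apply: cvgr_to_le gyz _; near=> m.
have [Wy _ yp] := yP m.
apply: cvgr_to_le (gg' _ Wy) _; near=> n; apply: yp.
by apply: ltnW; near: n; exact: eventually_gt.
Unshelve. all: by end_near. Qed.

(** The values at [v] stay in a compact interval, so they converge along [F]; the limit is linear
    and inherits the bound, hence is continuous. *)
Lemma ultralimit_functional (R : realType) (V : normedModType R)
    (F : set_system nat) (a : nat -> {linear V -> R^o}) (M : R) :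
  UltraFilter F -> (forall n v, `|a n v| <= M * `|v|) ->
  exists phi : {linear V -> R^o},
    continuous phi /\ forall v, a n v @[n --> F] --> phi v.
Proof.
move=> FU aM; have FP := @ultra_proper _ _ FU.
have /choice[phi phiP] : forall v, exists r : R,
    `|r| <= M * `|v| /\ (a n v : R) @[n --> F] --> r.
  move=> v; have := @segment_compact R (- (M * `|v|)) (M * `|v|).
  rewrite compact_ultra => /(_ _ (ultra_fmap (fun n => a n v : R) FU)).
  case=> [|r [rM ar]]; last first.
    by exists r; split=> //; move: rM; rewrite /= in_itv/= -ler_norml.
  by apply: nearW => n /=; rewrite in_itv/= -ler_norml.
have phi_lin : linear (phi : V -> R^o).
  move=> c u v; have [_ auv] := phiP (c *: u + v).
  apply: (cvg_unique (@Rhausdorff R) auv); rewrite /=.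
  have -> : (fun n => a n (c *: u + v) : R) =
            (fun n => c * (a n u : R) + (a n v : R)).
    by apply/funext => n; rewrite linearP.
  have [[_ au] [_ av]] := (phiP u, phiP v).
  by apply: cvgD => //; apply: cvgMr.
pose phiL := GRing.isLinear.Build R V R^o *:%R phi phi_lin.
pose Phi : {linear V -> R^o} := HB.pack phi phiL.
exists Phi; split=> [|v]; last by have [_] := phiP v.
apply: bounded_linear_continuous; apply/linear_boundedP.
near=> r => v; have [/le_trans + _] := phiP v; apply.
by apply: ler_wpM2r => //; near: r; exact: nbhs_pinfty_ge.
Unshelve. all: by end_near. Qed.

Lemma weak_eval_continuous (R : realType) (V : normedModType R)
    (phi : topological_dual V) :
  continuous (fun v : weak_space V => set_val phi v : R).
Proof.
pose E (v : weak_space V) : {ptws topological_dual V -> R} :=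
  fun psi => set_val psi v.
have Ec : continuous E by exact: (@initial_continuous V).
move=> v; exact: (cvg_comp E (fun g : {ptws _ -> R} => g phi) (Ec v)
  (@ptws_eval_continuous _ R phi (E v))).
Qed.

(* Used instead of Hahn-Banach: in a Hausdorff [K] embedded in a weak space,
   distinct points are separated by functionals. *)
Lemma weak_eval_inseparable (R : realType) (V : normedModType R)
    (v w : weak_space V) (U : set (weak_space V)) :
  (forall phi : topological_dual V, set_val phi v = set_val phi w) ->
  open U -> U v -> U w.
Proof.
move=> vw [B _ <-] /=; congr B.
by apply/funext => phi; exact: vw.
Qed.

Lemma eberlein_functions (R : realType) (K : topologicalType) :
  hausdorff_space K -> eberlein R K ->
  exists (I : Type) (f : K -> I -> R),
    [/\ forall i, continuous (f^~ i), injective f &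
        without_independent_pairs f].
Proof.
move=> K2 [V [W [cW [h [[hI hc ho] hW]]]]].
pose ev (phi : topological_dual V) (w : weak_space V) : R := set_val phi w.
have evc phi : continuous (ev phi) by exact: weak_eval_continuous.
exists (topological_dual V), (fun x phi => ev phi (h x)); split=> [phi|x y xy|].
- by move=> x; exact: (cvg_comp h (ev phi) (hc x) (evc phi (h x))).
- apply: K2 => A B; rewrite nbhsE => -[A' [oA' A'x] A'A] By.
  have [A'' oA'' hA'] := ho A' oA'; exists y; split; last exact: nbhs_singleton.
  have [A''x _] : (A'' `&` range h) (h x) by rewrite -hA'; exists x.
  have : (A'' `&` range h) (h y).
    split; last by exists y.
    apply: weak_eval_inseparable oA'' A''x => phi.
    exact: (congr1 (fun g : topological_dual V -> R => g phi) xy).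
  by rewrite -hA' => -[z A'z /hI <-]; exact: A'A.
(* Each piece is a ball of the dual, so a sequence in one piece is uniformly bounded and has an
   ultralimit. *)
move=> eps _; exists (fun n => [set phi | forall v : V,
  `|ev phi v| <= n%:R * `|v|]); split.
  apply/seteqP; split=> // phi _; have /set_mem phic := valP phi.
  have /continuous_linear_bounded/linear_boundedP[M [_ phiM]] :
    {for 0, continuous (set_val phi)} by exact: phic.
  have [n Mn] : exists n : nat, M < n%:R.
    exists (Num.bound `|M|).
    exact: le_lt_trans (ler_norm M) (archi_boundP (normr_ge0 M)).
  by exists n => //= v; exact: phiM.
move=> p q pq _ n [a [aJ [_ aind]]].
have [F [FU Foo]] := ultraFilterLemma eventually_filter.
have [phi [phic aphi]] := ultralimit_functional (a := set_val \o a) FU aJ.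
pose phi' : topological_dual V :=
  exist (fun f => f \in topological_dual V) phi (mem_set phic).
apply: (compact_double_limit FU Foo cW (fun n => evc (a n)) (evc phi') _ pq).
  by move=> x _; exact: aphi.
move=> m k.
(* The sign pattern is 1 before [m] and 0 from [m] on; [k.+1] pairs are taken since their number
   must be positive. *)
have [x xP] := aind k.+1 isT (fun j => (j < m)%N).
exists (h x); first by rewrite -hW; exists x.
move=> j jk; have := xP (Ordinal (ltnW jk : (j < k.+1)%N)) I.
rewrite /level_pairs/=.
by case: ifP.
Qed.

(** * Talagrand's compact is neither Eberlein nor QWRN *)

Lemma talagrand_hausdorff (R : realType) :
  hausdorff_space (set_type (talagrand R)).
Proof.
have H : hausdorff_space {ptws (nat -> nat) -> R}.
  by apply: (@hausdorff_product {classic (nat -> nat)} (fun=> R)) => _;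
    exact: Rhausdorff.
move=> u v uv; apply: val_inj; apply: H => A B Au Bv.
have [w [Aw Bw]] := uv _ _ (initial_continuous Au) (initial_continuous Bv).
by exists (set_val w).
Qed.

Theorem corollary2p13 (R : realType) :
  [/\ solid (talagrand R),
      corson R (set_type (talagrand R)),
      ~ eberlein R (set_type (talagrand R)) &
      ~ qwrn R (set_type (talagrand R))].
Proof.
split; [exact: talagrand_solid|exact: talagrand_corson| |].
  move=> /(eberlein_functions (@talagrand_hausdorff R)) [I [f [fc fI]]].
  exact: talagrand_independent_pairs.
(* The coordinates of the embedding are continuous and separate points. *)
move=> [I [f [[fI fc _] _]]]; apply: talagrand_independent_pairs => // i u.
exact: cvg_comp (fc u) (@ptws_eval_continuous _ R i (f u)).
Qed.
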